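(* Let $\alpha\in(-1,0)$ and let $\Delta:=\{(x,x):x\in[0,1]\}$. Let $\rho$ be a probability density on $[0,1]^2$ (with respect to Lebesgue measure) which is continuous on $[0,1]^2\setminus\Delta$ and satisfies $$\rho(x,y)=\Theta\left(|x-y|^{\alpha}\right)\quad\text{as }|x-y|\to0.$$ Then $$\mathbb{E}\left[\mathrm{LIS}\left(\mathrm{Sample}_N(\mu_\rho)\right)\right]=\widetilde{\Theta}\left(N^{1/(\alpha+2)}\right)\quad\text{as }N\to\infty.$$
   Context: For points $X_1,\dots,X_N\in[0,1]^2$ with pairwise distinct $x$-coordinates and pairwise distinct $y$-coordinates, $\mathrm{Perm}(X_1,\dots,X_N)$ is the permutation $\sigma$ of $\{1,\dots,N\}$ such that $\sigma(i)=j$ whenever the point with $i$-th lowest $x$-coordinate has $j$-th lowest $y$-coordinate. A pre-permuton is a probability measure $\mu$ on $[0,1]^2$ whose two marginals have no atoms. For a pre-permuton $\mu$, $\mathrm{Sample}_N(\mu)$ denotes the random permutation $\mathrm{Perm}(X_1,\dots,X_N)$ where $X_1,\dots,X_N$ are i.i.d. with law $\mu$ (almost surely well defined). For a probability density $\rho$ on $[0,1]^2$ with respect to Lebesgue measure, $\mu_\rho$ is the probability measure with density $\rho$. For a permutation $\sigma$ of size $N$, $\mathrm{LIS}(\sigma)$ is the maximal $k$ such that there exist $i_1<\dots<i_k$ with $\sigma(i_1)<\dots<\sigma(i_k)$. The hypothesis $\rho(x,y)=\Theta(|x-y|^\alpha)$ as $|x-y|\to0$ means that there are constants $0<c_1\le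 c_2$ and $\delta>0$ such that $c_1|x-y|^\alpha\le\rho(x,y)\le c_2|x-y|^\alpha$ for all $(x,y)\in[0,1]^2$ with $0<|x-y|<\delta$. For sequences of positive reals, $a_N=\widetilde{\mathcal O}(b_N)$ means that there exist $c_1>0$, $c_2\in\mathbb{R}$ and $N_0$ with $a_N\le c_1\log(N)^{c_2}b_N$ for all $N\ge N_0$; and $a_N=\widetilde{\Theta}(b_N)$ means $a_N=\widetilde{\mathcal O}(b_N)$ and $b_N=\widetilde{\mathcal O}(a_N)$. *)

(* Defs.v *)
From HB Require Import structures.
From mathcomp Require Import all_boot all_order all_algebra all_fingroup.
From mathcomp Require Import all_classical all_reals all_analysis.

Set Implicit Arguments.
Unset Strict Implicit.
Unset Printing Implicit Defensive.

Import Order.TTheory GRing.Theory Num.Theory.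
Import numFieldNormedType.Exports.

Local Open Scope classical_set_scope.
Local Open Scope ring_scope.

Section Permutations.

(* Indices are 0-based: [rank u k] is the number of values strictly below
   [u k], so the point with i-th lowest coordinate has rank i - 1. *)
Definition rank (R : realType) (N : nat) (u : 'I_N -> R) (k : 'I_N) : nat :=
  #|[set l : 'I_N | u l < u k]%SET|.

(* When the x-coordinates are pairwise distinct, and the y-coordinates too,
   exactly one permutation satisfies the condition; with ties, which for
   samples of a pre-permuton have probability zero, the value is irrelevant
   (it may be the default, the identity). *)
Definition perm_of_points (R : realType) (N : nat) (z : 'I_N -> R * R) : 'S_N :=
  odflt 1%g [pick s : 'S_N | [forall k : 'I_N, forall i : 'I_N, forall j : 'I_N,
    (rank (fun l => (z l).1) k == i) && (rank (fun l => (z l).2) k == j)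
      ==> (s i == j)]].

Definition has_increasing_subsequence (N : nat) (s : 'S_N) (k : nat) : bool :=
  [exists t : k.-tuple 'I_N,
    sorted ltn [seq val i | i <- t] && sorted ltn [seq val (s i) | i <- t]].

(* An increasing sequence of indices has at most N terms, so bounding k by N
   loses nothing. *)
Definition LIS (N : nat) (s : 'S_N) : nat :=
  (\max_(k < N.+1 | has_increasing_subsequence s k) k)%N.

End Permutations.

Section Densities.
Context {R : realType}.

Definition unit_square : set (R * R) := `[0, 1] `*` `[0, 1].

Definition diagonal : set (R * R) := [set z | z.1 = z.2 /\ z.1 \in `[0, 1]].

Local Notation leb2 := (@lebesgue_measure R \x @lebesgue_measure R)%E.

Definition probability_density (rho : R * R -> R) : Prop :=
  [/\ measurable_fun unit_square rho,
      forall z, unit_square z -> 0 <= rho z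
    & (\int[leb2]_(z in unit_square) (rho z)%:E = 1)%E].

Definition mu_density (rho : R * R -> R) (A : set (R * R)) : \bar R :=
  (\int[leb2]_(z in A `&` unit_square) (rho z)%:E)%E.

Definition Theta_near_diagonal (rho : R * R -> R) (alpha : R) : Prop :=
  exists c1 c2 delta : R,
    [/\ 0 < c1, c1 <= c2, 0 < delta
      & forall x y : R, unit_square (x, y) -> 0 < `|x - y| < delta ->
          c1 * `|x - y| `^ alpha <= rho (x, y) <= c2 * `|x - y| `^ alpha].

End Densities.

Section Samples.
Context {d d' : measure_display} {T : measurableType d} {S : measurableType d'}.
Context {R : realType} {P : probability T R}.

Definition mutually_independent (I : finType) (X : I -> {RV P >-> S}) : Prop :=
  forall (J : {set I}) (A : I -> set S),
    (forall i, i \in J -> measurable (A i)) ->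
    P (\bigcap_(i in [set` J]) (X i @^-1` A i)) =
    (\prod_(i in J) P (X i @^-1` A i))%E.

Definition iid_with_law (mu : set S -> \bar R) (I : finType)
    (X : I -> {RV P >-> S}) : Prop :=
  mutually_independent X /\
  forall i (A : set S), measurable A -> distribution P (X i) A = mu A.

End Samples.

(* The integrand takes values in {0, ..., N}, so the expectation is finite and
   [fine] is harmless. *)
Definition expected_LIS (d : measure_display) (T : measurableType d)
    (R : realType) (P : probability T R) (N : nat)
    (X : 'I_N -> {RV P >-> (R * R)%type}) : R :=
  fine ('E_P[fun w => (LIS (perm_of_points (fun i => X i w)))%:R]).

Section Asymptotics.
Context {R : realType}.

Definition soft_O (a b : nat -> R) : Prop :=
  exists c1 c2 : R, 0 < c1 /\ exists N0 : nat, forall N : nat, (N0 <= N)%N ->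
    a N <= c1 * (ln N%:R) `^ c2 * b N.

Definition soft_Theta (a b : nat -> R) : Prop := soft_O a b /\ soft_O b a.

End Asymptotics.

(* Main.v *)
(** Fix h of order N^(-1/(alpha+2)).  Since |x - y|^alpha is integrable in one
    variable, with integral at most a constant times s^(1+alpha) over every interval
    of length s, every h by h box has mass at most a constant times
    h^(2+alpha) ~ 1/N, wherever it lies relative to the diagonal.  By a union bound
    over boxes and over sets of points, with high probability no box of the grid
    contains more than 3 log N points; an increasing chain meets at most 2/h boxes,
    hence the upper bound N^(1/(alpha+2)) log N.  Conversely the 1/h boxes along the
    diagonal have mass at least a constant over N each, so a positive fraction of
    them is hit on average, and one point from each hit box gives an increasing
    subsequence. *)
Require Import Defs.
From mathcomp Require Import all_boot all_order all_algebra all_fingroup.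
From mathcomp Require Import all_classical all_reals all_analysis.
From mathcomp Require Import measurable_realfun.
From mathcomp Require Import ring lra zify.

Set Implicit Arguments.
Unset Strict Implicit.
Unset Printing Implicit Defensive.

Import Order.TTheory GRing.Theory Num.Theory.
Import numFieldNormedType.Exports.

Local Open Scope classical_set_scope.
Local Open Scope ring_scope.

(** * Mass estimates *)

Lemma le_integral_cst_measure (d : measure_display) (T : measurableType d) (R : realType)
    (mu : {measure set T -> \bar R}) (D E : set T) (f : T -> \bar R) (c : R) :
  measurable D -> measurable E -> D `<=` E -> measurable_fun D f -> 0 <= c ->
  (forall x, D x -> 0 <= f x)%E -> (forall x, D x -> f x <= c%:E)%E ->
  (\int[mu]_(x in D) f x <= c%:E * mu E)%E.
Proof.
move=> mD mE DE mf c0 f0 fc; apply: (@le_trans _ _ (c%:E * mu D))%E.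
  by rewrite -integral_cst//; exact: ge0_le_integral.
by apply: lee_wpmul2l; [rewrite lee_fin|apply: le_measure; rewrite ?inE].
Qed.

Lemma le0_ger_powR (R : realType) (a : R) : a <= 0 ->
  {in Num.pos &, {homo (fun x : R => x `^ a) : x y / x <= y >-> y <= x}}.
Proof.
move=> a0 x y x0 y0 xy; rewrite -(opprK a) (powRN x) (powRN y) lef_pV2 ?posrE ?powR_gt0//.
by apply: ge0_ler_powR; rewrite ?oppr_ge0// nnegrE ltW.
Qed.

(* The sum over the dyadic shells [s 2^-(n+1) < |x - y| <= s 2^-n] of their length
   times the supremum of [|x - y| `^ a], normalised by [s `^ (1 + a)]. *)
Definition singular_constant (R : realType) (a : R) : R :=
  1 + 2 * 2 `^ (- a) / (1 - 2 `^ (- (1 + a))).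

Lemma singular_constant_gt0 (R : realType) (a : R) : -1 < a -> 0 < singular_constant a.
Proof.
move=> a1; rewrite /singular_constant ltr_wpDr//.
rewrite divr_ge0 ?mulr_ge0 ?powR_ge0// subr_ge0 powRN invf_le1 ?powR_gt0//.
by rewrite -[leLHS](powRr0 (2 : R)) ler_powR ?ler1n//; lra.
Qed.

(** Dyadic decomposition of [[p, q]] around the singularity [x]: halving the distance to [x]
    multiplies the bound on [h] by 2 to the power [- a] but halves the length, so for [a > -1] the
    shells form a convergent geometric series. The result depends on the interval only through its
    length, hence is uniform in the position of [x]. *)
Lemma integral_singular_le (R : realType) (a C p q x : R) (h : R -> \bar R) :
  -1 < a < 0 -> 0 <= C -> p < q -> measurable_fun `[p, q] h ->
  (forall y, `[p, q]%classic y -> 0 <= h y)%E ->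
  (forall y, `[p, q]%classic y -> y != x -> h y <= (C * `|x - y| `^ a)%:E)%E ->
  (\int[lebesgue_measure]_(y in `[p, q]) h y <=
    (singular_constant a * C * (q - p) `^ (1 + a))%:E)%E.
Proof.
move=> /andP[a1 a0] C0 pq mh h0 hle.
pose s := q - p; have s0 : 0 < s by rewrite subr_gt0.
pose t : R := 2 `^ (- a).
have t0 : 0 < t by rewrite powR_gt0.
have rE : 2 `^ (- (1 + a)) = t / 2.
  by rewrite opprD powRD ?pnatr_eq0 ?implybT// powR_inv1// mulrC.
have t2 : t / 2 < 1.
  rewrite -rE powRN invf_lt1 ?powR_gt0//.
  have := @gt0_ltr_powR _ (1 + a) _ 1 2; rewrite powR1; apply; rewrite ?nnegrE ?ltr1n//; lra.
pose c (n : nat) := s * 2^-1 ^+ n.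
have c0 n : 0 < c n by rewrite mulr_gt0// exprn_gt0// invr_gt0.
have ca n : c n `^ a = s `^ a * t ^+ n.
  rewrite powRM ?ltW// ?exprn_gt0 ?invr_gt0//; congr (_ * _).
  elim: n => [|n IH]; first by rewrite !expr0 powR1.
  rewrite !exprS powRM ?invr_ge0 ?exprn_ge0 ?invr_ge0// IH; congr (_ * _).
  by rewrite -powR_inv1// -powRrM mulN1r.
(* What remains of the interval after removing the neighbourhood of [x] of radius [c n]. These sets
   increase to everything except [x], and the integral grows by one shell at a time. *)
pose E (n : nat) := `[p, q]%classic `\` `[x - c n, x + c n]%classic.
have mE n : measurable (E n) by exact: measurableD.
have mD n : measurable (E n.+1 `\` E n) by exact: measurableD.
have subE n : E n `<=` `[p, q]%classic by exact: subIsetl.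
have far n y : E n y -> y != x /\ c n <= `|x - y|.
  move=> [_ /=]; rewrite in_itv/= => H; split.
    by apply/eqP => yx; apply: H; rewrite yx; have := c0 n; lra.
  by rewrite leNgt; apply/negP => H1; apply: H; rewrite -ler_distlC ltW// distrC.
have bnd n y : E n y -> (h y <= (C * c n `^ a)%:E)%E.
  move=> Ey; have [yx cy] := far n y Ey.
  apply: le_trans (hle _ (subE _ _ Ey) yx) _; rewrite lee_fin ler_wpM2l//.
  by apply: le0_ger_powR => //; rewrite ?ltW// posrE// (lt_le_trans _ cy).
pose S (n : nat) : R := \sum_(j < n) (t / 2) ^+ j.
have s1a : s `^ (1 + a) = s * s `^ a.
  by rewrite powRD ?(gt_eqF s0) ?implybT// powRr1 ?ltW.
have subS n : E n `<=` E n.+1.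
  move=> y [By Hy]; split => //; apply: contra_not Hy => /=.
  rewrite !in_itv/= => /andP[H1 H2].
  have : c n.+1 <= c n.
    by rewrite /c ler_pM2l// exprS ler_piMl// ?exprn_ge0 ?invr_ge0// invf_le1 ?ler1n.
  by move: H1 H2; lra.
(* In units of [C] times the power of [s], the summand 1 is [E 0], of length at most [s] and at
   distance at least [s] from [x]. The shell between [E n] and [E n.+1] has length at most [2 * c n]
   and distance at least [c n.+1], which gives the term [2 * t * (t / 2) ^+ n]. *)
have step n : (\int[lebesgue_measure]_(y in E n) h y <=
    (C * s `^ (1 + a) * (1 + 2 * t * S n))%:E)%E.
  elim: n => [|n IH].
    have : (\int[lebesgue_measure]_(y in E 0%N) h y <=
        (C * c 0%N `^ a)%:E * lebesgue_measure `[p, q]%classic)%E.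
      apply: le_integral_cst_measure => //.
      - exact: mE.
      - exact: measurable_funS mh.
      - by rewrite mulr_ge0 ?powR_ge0.
      - by move=> y /subE; exact: h0.
      - by move=> y; exact: bnd.
    move=> /le_trans; apply; rewrite lebesgue_measure_itv/= lte_fin pq -EFinB -EFinM lee_fin.
    by rewrite /S big_ord0 ca expr0 s1a -/s; lra.
  have EE : E n.+1 = E n `|` (E n.+1 `\` E n).
    by rewrite setDUK.
  rewrite EE ge0_integral_setU//=; last 5 first.
  - exact: mE.
  - exact: mD.
  - rewrite -EE; exact: measurable_funS mh.
  - by move=> y [|[+ _]] => /subE; exact: h0.
  - by apply/disj_setPS => y [? [_]].
  have -> : C * s `^ (1 + a) * (1 + 2 * t * S n.+1) =
      C * s `^ (1 + a) * (1 + 2 * t * S n) + C * s `^ (1 + a) * (2 * t * (t / 2) ^+ n).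
    by rewrite /S big_ord_recr/=; ring.
  rewrite EFinD; apply: leeD => //.
  have : (\int[lebesgue_measure]_(y in E n.+1 `\` E n) h y <=
      (C * c n.+1 `^ a)%:E * lebesgue_measure `[(x - c n)%R, (x + c n)%R]%classic)%E.
    apply: le_integral_cst_measure => //.
    - exact: mD.
    - by move=> y [[By _]]; apply: contra_notP => Hy.
    - by apply: measurable_funS mh => //; apply: subset_trans (subE n.+1); exact: subIsetl.
    - by rewrite mulr_ge0 ?powR_ge0.
    - by move=> y [/subE ? _]; exact: h0.
    - by move=> y [? _]; exact: bnd.
  move=> /le_trans; apply; rewrite lebesgue_measure_itv/= lte_fin ifT; last by have := c0 n; lra.
  rewrite -EFinB -EFinM lee_fin ca s1a.
  rewrite opprB addrAC addrCA subrr addr0 /c exprMn_comm; last exact: mulrC.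
  rewrite exprS le_eqVlt; apply/orP; left; apply/eqP; ring.
have Sle n : S n <= (1 - t / 2)^-1.
  have := subrX1 (t / 2) n; rewrite -/(S n) => H.
  rewrite -[leRHS]mul1r ler_pdivlMr ?subr_gt0//.
  have : 0 <= (t / 2) ^+ n by rewrite exprn_ge0// divr_ge0// ltW.
  by move: H; rewrite /S; lra.
pose B := \bigcup_n E n.
have mB : measurable B by exact: bigcupT_measurable.
have BE : `[p, q]%classic `\` [set x] `<=` B.
  move=> y [By /eqP yx]; have xy0 : 0 < `|y - x| by rewrite normr_gt0 subr_eq0.
  have [n cn] : exists n, c n < `|y - x|.
    (* For this [n], the quotient of [s] by the distance is below [n.+1], and [n.+1 <= 2 ^ n]. *)
    exists (Num.truncn (s / `|y - x|)); rewrite /c.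
    have := truncnS_gt (s / `|y - x|); move: (Num.truncn _) => n.
    rewrite exprVn ltr_pdivrMr// ltr_pdivrMr ?exprn_gt0// => H; apply: (lt_le_trans H).
    by rewrite mulrC ler_pM2l// -natrX ler_nat ltn_expl.
  exists n => //; split => //= ; rewrite in_itv/= -ler_distlC.
  by rewrite distrC => /(lt_le_trans cn); rewrite ltxx.
have homoE : {homo E : n m / (n <= m)%N >-> (n <= m)%O}.
  by apply/nondecreasing_seqP => n; apply/subsetPset; exact: subS.
have subB : B `<=` `[p, q]%classic by move=> y [n _ /subE].
have bnd_B : (\int[lebesgue_measure]_(y in B) h y <=
    (singular_constant a * C * s `^ (1 + a))%:E)%E.
  have cv : (\int[lebesgue_measure]_(y in E n) h y)%E @[n --> \oo] -->
      (\int[lebesgue_measure]_(y in B) h y)%E.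
    apply: ge0_nondecreasing_set_cvg_integral => // n.
      exact: measurable_funS mh.
    by move=> y /subE; exact: h0.
  rewrite -(cvg_lim _ cv)//; apply: lime_le; first by apply/cvg_ex; eexists; exact: cv.
  apply: nearW => n; apply: le_trans (step n) _.
  rewrite lee_fin /singular_constant rE mulrC mulrA ler_wpM2r ?powR_ge0//.
  rewrite ler_wpM2r// lerD2l -/t ler_wpM2l// ?mulr_ge0// ltW//.
apply: le_trans bnd_B.
(* The value of [h] at [x] is uncontrolled, but a single point is a null set. *)
rewrite (@ge0_negligible_integral _ _ _ lebesgue_measure _ [set x])//; last first.
  exact: lebesgue_measure_set1.
apply: ge0_subset_integral => //; first exact: measurableD.
  exact: measurable_funS mh.
by move=> y /subB; exact: h0.
Qed.

(** Tonelli applied to the zero extension of [f]: a bound on the sections that is uniform over [A]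
    costs only the factor [m1 A]. *)
Lemma integral_setX_le1 (d1 d2 : measure_display) (T1 : measurableType d1)
    (T2 : measurableType d2) (R : realType)
    (m1 : {sigma_finite_measure set T1 -> \bar R})
    (m2 : {sigma_finite_measure set T2 -> \bar R})
    (A : set T1) (B : set T2) (f : T1 * T2 -> \bar R) (c : R) :
  measurable A -> measurable B -> measurable_fun (A `*` B) f ->
  (forall z, (A `*` B) z -> 0 <= f z)%E -> 0 <= c ->
  (forall x, A x -> \int[m2]_(y in B) f (x, y) <= c%:E)%E ->
  (\int[m1 \x m2]_(z in A `*` B) f z <= c%:E * m1 A)%E.
Proof.
move=> mA mB mf f0 c0 fc.
have mAB : measurable (A `*` B) by exact: measurableX.
have mg : measurable_fun setT (f \_ (A `*` B)) by apply/(measurable_restrictT _ mAB).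
have g0 z : (0 <= (f \_ (A `*` B)) z)%E by apply: erestrict_ge0.
rewrite integral_mkcond fubini_tonelli1//.
pose F := fubini_F m2 (f \_ (A `*` B)).
have FA x : A x -> F x = (\int[m2]_(y in B) f (x, y))%E.
  move=> Ax; rewrite integral_mkcond; apply: eq_integral => y _.
  rewrite !patchE; congr (if _ then _ else _).
  by apply/idP/idP; rewrite !inE => // -[].
rewrite (_ : fubini_F _ _ = F \_ A); last first.
  apply/funext => x; rewrite patchE; case: ifPn => //; rewrite notin_setE => Ax.
  rewrite /fubini_F integral0_eq// => y _; rewrite patchE ifN// notin_setE.
  by case.
have mF : measurable_fun setT F by exact: measurable_fun_fubini_tonelli_F.
rewrite -integral_mkcond; apply: le_integral_cst_measure => //.
- exact: measurable_funTS.
- by move=> x _; apply: integral_ge0 => y _.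
- by move=> x Ax; rewrite FA// fc.
Qed.

Lemma integral_setX_le2 (d1 d2 : measure_display) (T1 : measurableType d1)
    (T2 : measurableType d2) (R : realType)
    (m1 : {sigma_finite_measure set T1 -> \bar R})
    (m2 : {sigma_finite_measure set T2 -> \bar R})
    (A : set T1) (B : set T2) (f : T1 * T2 -> \bar R) (c : R) :
  measurable A -> measurable B -> measurable_fun (A `*` B) f ->
  (forall z, (A `*` B) z -> 0 <= f z)%E -> 0 <= c ->
  (forall y, B y -> \int[m1]_(x in A) f (x, y) <= c%:E)%E ->
  (\int[m1 \x m2]_(z in A `*` B) f z <= c%:E * m2 B)%E.
Proof.
move=> mA mB mf f0 c0 fc.
have mAB : measurable (A `*` B) by exact: measurableX.
have mg : measurable_fun setT (f \_ (A `*` B)) by apply/(measurable_restrictT _ mAB).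
have g0 z : (0 <= (f \_ (A `*` B)) z)%E by apply: erestrict_ge0.
rewrite integral_mkcond fubini_tonelli2//.
pose F := fubini_G m1 (f \_ (A `*` B)).
have FB y : B y -> F y = (\int[m1]_(x in A) f (x, y))%E.
  move=> By; rewrite integral_mkcond; apply: eq_integral => x _.
  rewrite !patchE; congr (if _ then _ else _).
  by apply/idP/idP; rewrite !inE => // -[].
rewrite (_ : fubini_G _ _ = F \_ B); last first.
  apply/funext => y; rewrite patchE; case: ifPn => //; rewrite notin_setE => By.
  rewrite /fubini_G integral0_eq// => x _; rewrite patchE ifN// notin_setE.
  by case.
have mF : measurable_fun setT F by exact: measurable_fun_fubini_tonelli_G.
rewrite -integral_mkcond; apply: le_integral_cst_measure => //.
- exact: measurable_funTS.
- by move=> y _; apply: integral_ge0 => x _.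
- by move=> y By; rewrite FB// fc.
Qed.

Lemma measurable_unit_square (R : realType) : measurable (@unit_square R).
Proof. by apply: measurableX. Qed.

(** Makes the local upper bound global. At distance at least [delta] from the diagonal, [rho] is
    continuous on a compact set, hence bounded; since distances in the square are at most 1 and
    [alpha < 0], the power is at least 1 and dominates that bound up to a constant. *)
Lemma Theta_near_diagonal_ub (R : realType) (alpha : R) (rho : R * R -> R) :
  alpha < 0 -> {within unit_square `\` diagonal, continuous rho} ->
  Theta_near_diagonal rho alpha ->
  exists2 C : R, 0 < C & forall x y, unit_square (x, y) -> x != y ->
    rho (x, y) <= C * `|x - y| `^ alpha.
Proof.
move=> a0 crho [c1 [c2 [delta [c10 c12 delta0 H]]]].
pose K : set (R * R) := unit_square `&` [set z | delta <= `|z.1 - z.2|].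
have cK : compact K.
  apply: compact_closedI; first by apply: compact_setX; exact: segment_compact.
  apply: (@preimage_closed _ _ (fun z : R * R => `|z.1 - z.2|) [set x | delta <= x]);
    last exact: closed_ge.
  by move=> z _; apply: cvg_norm; apply: cvgB; [exact: cvg_fst|exact: cvg_snd].
have : compact (rho @` K).
  apply: continuous_compact => //; apply: continuous_subspaceW crho.
  move=> [x y] [sq /= dxy]; split => //.
  by rewrite /diagonal /= => xy; move: dxy; rewrite xy subrr normr0 leNgt delta0.
move=> /compact_bounded[M [_ HM]].
have {}HM z : K z -> rho z <= `|M| + 1.
  move=> Kz; apply: le_trans (ler_norm _) _; apply: (HM (`|M| + 1)).
    by rewrite (le_lt_trans (ler_norm _))// ltrDl.
  by exists z.
exists (c2 + (`|M| + 1)); first by have := normr_ge0 M; lra.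
move=> x y sq xy.
have xy0 : 0 < `|x - y| by rewrite normr_gt0 subr_eq0.
have p0 : 0 <= `|x - y| `^ alpha by rewrite powR_ge0.
rewrite mulrDl; have [lt_d|ge_d] := ltP `|x - y| delta.
  have /andP[_ h] : c1 * `|x - y| `^ alpha <= rho (x, y) <= c2 * `|x - y| `^ alpha.
    by apply: H => //; rewrite xy0.
  by rewrite (le_trans h)// lerDl mulr_ge0// addr_ge0.
apply: (@le_trans _ _ (`|M| + 1)); first exact: HM.
rewrite ler_wpDl ?mulr_ge0//; first by lra.
rewrite ler_peMr ?addr_ge0//.
have := @le0_ger_powR _ alpha (ltW a0) `|x - y| 1; rewrite powR1; apply; rewrite ?posrE//.
move: sq => -[/=]; rewrite !in_itv/= => /andP[? ?] /andP[? ?].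
by rewrite ler_norml; lra.
Qed.

Lemma mu_density_restrict (R : realType) (rho : R * R -> R) (D : set (R * R)) :
  mu_density rho D =
  (\int[(@lebesgue_measure R \x @lebesgue_measure R)%E]_(z in D)
    ((EFin \o rho) \_ unit_square) z)%E.
Proof. by rewrite /mu_density -integral_mkcondr. Qed.

Section density_bounds.
Variables (R : realType) (rho : R * R -> R) (alpha C : R).
Hypothesis halpha : -1 < alpha < 0.
Hypothesis mrho : measurable_fun unit_square rho.
Hypothesis rho0 : forall z, unit_square z -> 0 <= rho z.
Hypothesis C0 : 0 < C.
Hypothesis rhoC : forall x y, unit_square (x, y) -> x != y ->
  rho (x, y) <= C * `|x - y| `^ alpha.

(** The zero extension of [rho] satisfies the singular bound [fC] at every off-diagonal point of the
    plane, so boxes that stick out of the square need no separate treatment. *)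
Let f := (EFin \o rho) \_ unit_square.

Let mf : measurable_fun setT f.
Proof.
by apply/(measurable_restrictT _ (@measurable_unit_square R)); exact/measurable_EFinP.
Qed.

Let f0 z : (0 <= f z)%E.
Proof. by apply: erestrict_ge0 => x sqx; rewrite lee_fin; exact: rho0. Qed.

Let fC x y : x != y -> (f (x, y) <= (C * `|x - y| `^ alpha)%:E)%E.
Proof.
move=> xy; rewrite /f patchE; case: ifPn => [|_].
  by rewrite inE => sq; rewrite lee_fin; exact: rhoC.
by rewrite lee_fin mulr_ge0 ?powR_ge0// ltW.
Qed.

(** Every section at fixed [x] is an integral with its singularity at [y = x], to which
    [integral_singular_le] applies uniformly in [x]. *)
Lemma mu_density_ub_snd (A : set R) (p q : R) : measurable A -> p < q ->
  (mu_density rho (A `*` `[p, q]) <=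
    (singular_constant alpha * C * (q - p) `^ (1 + alpha))%:E * lebesgue_measure A)%E.
Proof.
move=> mA pq; rewrite mu_density_restrict; apply: integral_setX_le1 => //.
- exact: measurable_funTS.
- have /andP[a1 _] := halpha.
  by rewrite !mulr_ge0 ?powR_ge0 ?ltW// singular_constant_gt0.
- move=> x _; apply: integral_singular_le => //.
  + exact: ltW.
  + by apply: measurable_funTS; exact: measurableT_comp.
  + by move=> y _ yx; apply: fC; rewrite eq_sym.
Qed.

Lemma mu_density_ub_fst (B : set R) (p q : R) : measurable B -> p < q ->
  (mu_density rho (`[p, q] `*` B) <=
    (singular_constant alpha * C * (q - p) `^ (1 + alpha))%:E * lebesgue_measure B)%E.
Proof.
move=> mB pq; rewrite mu_density_restrict; apply: integral_setX_le2 => //.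
- exact: measurable_funTS.
- have /andP[a1 _] := halpha.
  by rewrite !mulr_ge0 ?powR_ge0 ?ltW// singular_constant_gt0.
- move=> y _; apply: (@integral_singular_le _ _ _ _ _ y) => //.
  + exact: ltW.
  + by apply: measurable_funTS; exact: measurableT_comp.
  + by move=> x _ yx; rewrite distrC; apply: fC.
Qed.

Lemma mu_density_box_ub (p r h : R) : 0 < h ->
  (mu_density rho (`[p, (p + h)%R] `*` `[r, (r + h)%R]) <=
    (singular_constant alpha * C * h `^ (2 + alpha))%:E)%E.
Proof.
move=> h0; apply: (le_trans (mu_density_ub_snd _ _)) => //; first by rewrite ltrDl.
rewrite lebesgue_measure_itv/= lte_fin ltrDl h0 -EFinB -EFinM lee_fin.
rewrite (addrC r) (addrC p) !addrK -mulrA [_ * h]mulrC.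
have -> : 2 + alpha = 1 + (1 + alpha) by lra.
rewrite (@powRD _ h 1 (1 + alpha)) ?(gt_eqF h0) ?implybT//.
by rewrite (powRr1 (ltW h0)) -mulrA mulrCA [h * (C * _)]mulrCA.
Qed.

Lemma mu_density_setC : mu_density rho (~` unit_square) = 0%E.
Proof. by rewrite /mu_density setICl integral_set0. Qed.

(** Only the part inside the square carries mass, so the strip reduces to a box of height 1. The
    bound is linear in the width, as required for excluding ties between first coordinates. *)
Lemma mu_density_strip1 (p h : R) : 0 < h ->
  (mu_density rho (`[p, (p + h)%R] `*` setT) <= (singular_constant alpha * C * h)%:E)%E.
Proof.
move=> h0; rewrite (_ : mu_density _ _ = mu_density rho (`[p, (p + h)%R] `*` `[0, 1])).
  apply: (le_trans (mu_density_ub_snd _ _)) => //.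
  rewrite lebesgue_measure_itv/= lte_fin ltrDl h0 -EFinB -EFinM lee_fin.
  by rewrite subr0 powR1 mulr1 [p + h]addrC addrK.
rewrite /mu_density; congr integral; apply/seteqP.
by split => -[x y] [[/= ? ?] [/= ? ?]].
Qed.

Lemma mu_density_strip2 (p h : R) : 0 < h ->
  (mu_density rho (setT `*` `[p, (p + h)%R]) <= (singular_constant alpha * C * h)%:E)%E.
Proof.
move=> h0; rewrite (_ : mu_density _ _ = mu_density rho (`[0, 1] `*` `[p, (p + h)%R])).
  apply: (le_trans (mu_density_ub_fst _ _)) => //.
  rewrite lebesgue_measure_itv/= lte_fin ltrDl h0 -EFinB -EFinM lee_fin.
  by rewrite subr0 powR1 mulr1 [p + h]addrC addrK.
rewrite /mu_density; congr integral; apply/seteqP.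
by split => -[x y] [[/= ? ?] [/= ? ?]].
Qed.

End density_bounds.

(** The box is the upper left quarter of a diagonal square of side [h]: its area is a quarter of
    [h ^+ 2], and distances in it are at most [h], so the decreasing power is at least its value at
    [h]. The half-open side keeps the box off the diagonal, where [rho] is not controlled. *)
Lemma mu_density_diagonal_box_lb (R : realType) (rho : R * R -> R) (alpha c delta : R) :
  alpha < 0 -> measurable_fun unit_square rho ->
  (forall z, unit_square z -> 0 <= rho z) -> 0 < c ->
  (forall x y, unit_square (x, y) -> 0 < `|x - y| < delta ->
    c * `|x - y| `^ alpha <= rho (x, y)) ->
  forall u h : R, 0 <= u -> 0 < h < delta -> u + h <= 1 ->
  ((c / 4 * h `^ (2 + alpha))%:E <=
    mu_density rho (`[u, (u + h / 2)%R[ `*` `[(u + h / 2)%R, (u + h)%R]))%E.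
Proof.
move=> a0 mrho rho0 c0 rhoc u h u0 /andP[h0 hd] uh1.
set A := `[u, _[; set B := `[(u + h / 2)%R, _].
have sub : [set` A] `*` [set` B] `<=` unit_square.
  by move=> [x y] [/=]; rewrite !in_itv/= => /andP[? ?] /andP[? ?]; split => /=;
    rewrite in_itv/=; lra.
rewrite /mu_density (setIidl sub).
have mA : measurable ([set` A] : set R) by [].
have mB : measurable ([set` B] : set R) by [].
have mAB := measurableX mA mB.
have <- : (\int[(@lebesgue_measure R \x @lebesgue_measure R)%E]_(z in [set` A] `*` [set` B])
    (c * h `^ alpha)%:E = (c / 4 * h `^ (2 + alpha))%:E)%E.
  rewrite integral_cst//.
  transitivity ((c * h `^ alpha)%:E *
      (lebesgue_measure [set` A] * lebesgue_measure [set` B]))%E.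
    by congr (_ * _)%E; exact: product_measure1E.
  rewrite !lebesgue_measure_itv/= !lte_fin ifT; last by lra.
  rewrite ifT; last by lra.
  rewrite -!EFinB -!EFinM; congr EFin.
  by rewrite powRD ?(gt_eqF h0) ?implybT// (powR_mulrn 2 (ltW h0)); field.
apply: ge0_le_integral => //.
- by move=> z _; rewrite lee_fin mulr_ge0 ?powR_ge0 ?ltW.
- by apply/measurable_EFinP; apply: measurable_funS mrho => //; exact: measurable_unit_square.
- move=> [x y] ABxy; have sqxy := sub _ ABxy; move: ABxy => [/=].
  rewrite !in_itv/= lee_fin => /andP[? ?] /andP[? ?].
  have xy0 : 0 < `|x - y| by rewrite normr_gt0 lt_eqF// subr_lt0; lra.
  have xyh : `|x - y| <= h by rewrite ler_norml; lra.
  apply: (@le_trans _ _ (c * `|x - y| `^ alpha)).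
    by rewrite ler_wpM2l ?(ltW c0)//; apply: le0_ger_powR; rewrite ?posrE// ltW.
  by apply: rhoc => //; rewrite xy0 (le_lt_trans xyh).
Qed.

(** * Increasing subsequences of point sets *)

(** The set counted by the rank grows with the value, strictly because [k] itself enters it once
    [u k < u l]. *)
Lemma rank_ltE (R : realType) (N : nat) (u : 'I_N -> R) (k l : 'I_N) :
  (rank u k < rank u l)%N = (u k < u l).
Proof.
have [kl|lk] := ltP (u k) (u l); last first.
  apply/negbTE; rewrite -leqNgt; apply/subset_leq_card/fintype.subsetP => i.
  by rewrite !inE => /lt_le_trans; apply.
apply/proper_card/properP; split; last by exists k; rewrite inE// ltxx.
by apply/fintype.subsetP => i; rewrite !inE => /lt_trans; apply.
Qed.

Lemma rank_ltn (R : realType) (N : nat) (u : 'I_N -> R) (k : 'I_N) : (rank u k < N)%N.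
Proof.
rewrite -[ltnRHS]card_ord /rank -cardsT; apply/proper_card/properP; split.
  exact: finset.subsetT.
by exists k; rewrite inE// ltxx.
Qed.

Lemma rank_inj (R : realType) (N : nat) (u : 'I_N -> R) :
  injective u -> injective (rank u).
Proof.
move=> uI k l kl; apply: uI; apply/eqP; rewrite eq_le !leNgt.
by rewrite -!rank_ltE kl ltnn.
Qed.

(** Replaces the choice in [perm_of_points] by an equation. The inverse of the first rank
    permutation followed by the second one satisfies the predicate, so the default is never reached,
    and the predicate determines any chosen permutation at each [r1 k]. *)
Lemma perm_of_points_rank (R : realType) (N : nat) (z : 'I_N -> R * R) :
  injective (fst \o z) -> injective (snd \o z) ->
  exists r1 r2 : 'S_N,
    [/\ forall k, r1 k = rank (fst \o z) k :> nat,
        forall k, r2 k = rank (snd \o z) k :> nat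
      & forall k, perm_of_points z (r1 k) = r2 k].
Proof.
move=> inj1 inj2.
pose f1 k := Ordinal (rank_ltn (fst \o z) k).
pose f2 k := Ordinal (rank_ltn (snd \o z) k).
have f1I : injective f1 by move=> k l /(congr1 val)/(rank_inj inj1).
have f2I : injective f2 by move=> k l /(congr1 val)/(rank_inj inj2).
exists (perm f1I), (perm f2I); split=> [k|k|k]; rewrite ?permE//.
rewrite /perm_of_points; case: pickP => [s /= /forallP/(_ k)|/=].
  move=> /forallP/(_ (f1 k))/forallP/(_ (f2 k)).
  by rewrite [X in X ==> _](_ : _ = true) ?implyTb => [/eqP ->//|]; rewrite !eqxx.
move=> /(_ ((perm f1I)^-1 * perm f2I)%g)/negP[].
apply/forallP => l; apply/forallP => i; apply/forallP => j; apply/implyP.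
move=> /andP[/eqP li /eqP lj].
have -> : i = perm f1I l by apply/val_inj; rewrite /= permE.
by rewrite permM permK permE -val_eqE/=; apply/eqP.
Qed.

(** Chains expressed by the points alone; the next two lemmas trade them for increasing
    subsequences, so that ranks and sorted tuples do not occur in the probabilistic arguments. *)
Definition increasing_points (R : realType) (N : nat) (z : 'I_N -> R * R)
    (A : {set 'I_N}) : Prop :=
  {in A &, forall i j, (z i).1 < (z j).1 -> (z i).2 < (z j).2}.

Lemma increasing_points_le_LIS (R : realType) (N : nat) (z : 'I_N -> R * R)
    (A : {set 'I_N}) :
  injective (fst \o z) -> injective (snd \o z) ->
  increasing_points z A -> (#|A| <= LIS (perm_of_points z))%N.
Proof.
move=> inj1 inj2 incA.
have [r1 [r2 [r1E r2E sE]]] := perm_of_points_rank inj1 inj2.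
set s := perm_of_points z in sE *.
pose B := [set r1 i | i in A]%SET.
have cardB : size (enum B) == #|A| by rewrite -cardE card_imset//; exact: perm_inj.
have ltN : (#|A| < N.+1)%N by rewrite ltnS -[leqRHS]card_ord max_card.
(* [enum] lists ordinals in increasing order, so the positions [r1 i] of the chain, enumerated as
   [B], are already sorted; only monotonicity of [s] remains. *)
have sB : sorted (relpre (val : 'I_N -> nat) ltn) (enum B).
  rewrite /(enum B) /= /enum_mem; apply: sorted_filter; first by move=> ? ? ? /=; exact: ltn_trans.
  by rewrite -sorted_map -enumT val_enum_ord iota_ltn_sorted.
apply: (bigop.leq_bigmax_cond (Ordinal ltN)).
apply/existsP; exists (Tuple cardB); rewrite /= !sorted_map sB/=.
apply: (@sub_in_sorted _ (mem (enum B)) _ _ _ _ _ sB); last by apply/allP.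
move=> i j; rewrite !mem_enum => /imsetP[a aA ->] /imsetP[b bA ->] /=.
rewrite !sE r1E r1E r2E r2E !rank_ltE; exact: incA.
Qed.

(** A subsequence of positions pulls back along [r1] to a chain of points of the same size. *)
Lemma LIS_le_increasing_points (R : realType) (N : nat) (z : 'I_N -> R * R) (b : nat) :
  injective (fst \o z) -> injective (snd \o z) ->
  (forall A, increasing_points z A -> (#|A| <= b)%N) ->
  (LIS (perm_of_points z) <= b)%N.
Proof.
move=> inj1 inj2 Ab.
have [r1 [r2 [r1E r2E sE]]] := perm_of_points_rank inj1 inj2.
rewrite /LIS; set s := perm_of_points z in sE *.
apply/bigmax_leqP => k /existsP[t /andP[s1 s2]].
pose A := [set i | r1 i \in t]%SET.
have ut : uniq t by rewrite -(map_inj_uniq val_inj); exact: (sorted_uniq ltn_trans ltnn).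
have <- : #|A| = k.
  rewrite -[RHS](size_tuple t) -(card_uniqP ut) -(card_imset _ (@perm_inj _ r1)).
  apply: eq_card => i; apply/imsetP/idP => [[j + ->]|it]; first by rewrite inE.
  by exists ((r1^-1)%g i); rewrite ?inE ?permKV.
apply: Ab => i j; rewrite !inE => it jt.
rewrite -/((fst \o z) i) -/((fst \o z) j) -/((snd \o z) i) -/((snd \o z) j).
rewrite -!rank_ltE -!r1E -!r2E -!sE => ij.
(* Used twice: by contradiction with [f := r1]-positions to order the indices in [t], then with the
   values of [s] to order the images. *)
have mono (f : 'I_N -> nat) : sorted ltn [seq f l | l <- t] ->
    forall a b, a \in t -> b \in t -> (index a t < index b t)%N -> (f a < f b)%N.
  move=> sf a b' at_ bt ab.
  have := @sorted_ltn_nth _ ltn ltn_trans 0%N _ sf (index a t) (index b' t).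
  rewrite !inE !size_map !index_mem => /(_ at_ bt ab).
  by rewrite !(nth_map a) ?index_mem// !nth_index.
apply: (mono (fun i => val (s i)) s2) => //.
rewrite ltnNge leq_eqVlt; apply/negP => /orP[/eqP e|lt].
  by move: ij; rewrite -(nth_index (r1 i) it) -(nth_index (r1 i) jt) e ltnn.
by have := mono _ s1 _ _ jt it lt; rewrite ltnNge ltnW.
Qed.

(* Along a chain both coordinates are monotone, so cells with equal coordinate sum
   coincide. *)
Lemma card_monotone_grid_le (N M t : nat) (A : {set 'I_N}) (f1 f2 : 'I_N -> nat) :
  {in A &, forall i j, (f1 i <= f1 j)%N && (f2 i <= f2 j)%N ||
                       (f1 j <= f1 i)%N && (f2 j <= f2 i)%N} ->
  {in A, forall i, (f1 i + f2 i < M)%N} ->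
  (forall a b, (#|[set i in A | (f1 i == a) && (f2 i == b)]%SET| <= t)%N) ->
  (#|A| <= M * t)%N.
Proof.
move=> mono lM box.
have -> : A = (\bigcup_(d < M) [set i in A | f1 i + f2 i == d]%N)%SET.
  apply/setP => i; apply/idP/bigcupP => [iA|[d _]]; last by rewrite inE => /andP[].
  by exists (Ordinal (lM _ iA)); rewrite ?inE ?iA/=.
have -> : (M * t)%N = (\sum_(d < M) t)%N by rewrite sum_nat_const card_ord.
elim/big_rec2 : _ => [|d c U _ Uc]; first by rewrite cards0.
apply: (leq_trans (leq_card_setU _ _)); apply: leq_add => //.
have [->|[i]] := set_0Vmem [set i in A | f1 i + f2 i == d]%SET; first by rewrite cards0.
rewrite inE => /andP[iA /eqP di]; apply: leq_trans (box (f1 i) (f2 i)).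
apply/subset_leq_card/fintype.subsetP => j; rewrite !inE => /andP[jA /eqP dj].
by rewrite jA/=; have := mono _ _ iA jA; lia.
Qed.

(** * Samples *)

(* The minimum puts the endpoint [v = 1] in the last cell. *)
Definition grid_cell (R : realType) (n : nat) (v : R) : nat :=
  minn (Num.truncn (v * n.+1%:R)) n.

Lemma grid_cell_lt (R : realType) (n : nat) (v : R) : (grid_cell n v < n.+1)%N.
Proof. by rewrite ltnS geq_minr. Qed.

Lemma grid_cell_le (R : realType) (n : nat) (v w : R) :
  v <= w -> (grid_cell n v <= grid_cell n w)%N.
Proof.
move=> vw; rewrite /grid_cell leq_min geq_minr andbT (leq_trans (geq_minl _ _))//.
by apply: le_truncn; rewrite ler_wpM2r.
Qed.

Lemma grid_cell_itv (R : realType) (n : nat) (v : R) : 0 <= v <= 1 ->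
  v \in `[(grid_cell n v)%:R * n.+1%:R^-1,
          (grid_cell n v)%:R * n.+1%:R^-1 + n.+1%:R^-1].
Proof.
move=> /andP[v0 v1]; have n0 : 0 < n.+1%:R :> R by [].
rewrite in_itv/= -[X in _ + X]mul1r -mulrDl ler_pdivrMr// ler_pdivlMr// natr1.
have /truncn_itv/andP[h1 h2] : 0 <= v * n.+1%:R by rewrite mulr_ge0.
rewrite /grid_cell; case: leqP => h; first by rewrite h1 ltW.
rewrite (le_trans _ h1) ?ler_nat ?(ltnW h)//=.
by rewrite ler_piMl.
Qed.

Lemma measure_finite_union_le (d : measure_display) (T : measurableType d) (R : realType)
    (P : {measure set T -> \bar R}) (I : choiceType) (s : seq I) (F : I -> set T) (c : R) :
  (forall i, measurable (F i)) -> (forall i, i \in s -> (P (F i) <= c%:E)%E) ->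
  (P (\bigcup_(i in [set` s]) F i) <= ((size s)%:R * c)%:E)%E.
Proof.
move=> mF; elim: s => [|i s IH] sc; first by rewrite bigcup_seq big_nil measure0 mul0r.
rewrite !bigcup_seq big_cons; apply: (le_trans (measureU2 _ _ _)) => //.
  exact: bigsetU_measurable.
have -> : (size (i :: s))%:R * c = c + (size s)%:R * c.
  by rewrite /= -natr1 mulrDl mul1r addrC.
rewrite EFinD; apply: leeD; first by apply: sc; rewrite mem_head.
by rewrite -bigcup_seq; apply: IH => j js; apply: sc; rewrite in_cons js orbT.
Qed.

Lemma finite_valued_measurable (d d' : measure_display) (T : measurableType d)
    (S : measurableType d') (F : finType) (f : T -> F) (g : F -> S) :
  (forall c, measurable (f @^-1` [set c])) -> measurable_fun setT (g \o f).
Proof.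
move=> mf _ Y mY; rewrite setTI.
rewrite (_ : _ @^-1` Y = \bigcup_(c in [set c | Y (g c)]) f @^-1` [set c]).
  by apply: fin_bigcup_measurable.
by apply/seteqP; split => [w Yw|w [c Yc /= ->]]; first by exists (f w).
Qed.

Section iid_samples.
Variables (d : measure_display) (T : measurableType d) (R : realType) (P : probability T R).
Variables (N : nat) (X : 'I_N -> {RV P >-> (R * R)%type}).
Local Notation LISX := (fun w => LIS (perm_of_points (fun i => X i w))).

Let measurable_coord1 i : measurable_fun setT (fun w => (X i w).1).
Proof. by apply: measurableT_comp. Qed.

Let measurable_coord2 i : measurable_fun setT (fun w => (X i w).2).
Proof. by apply: measurableT_comp. Qed.

(* The permutation depends on the points only through finitely many comparisons. *)
Lemma measurable_LIS : measurable_fun setT (fun w => (LISX w)%:R : R).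
Proof.
pose code w : {ffun 'I_N * 'I_N -> bool * bool} :=
  [ffun p => ((X p.1 w).1 < (X p.2 w).1, (X p.1 w).2 < (X p.2 w).2)].
pose G (c : {ffun 'I_N * 'I_N -> bool * bool}) : 'S_N :=
  odflt 1%g [pick s : 'S_N | [forall k : 'I_N, forall i : 'I_N, forall j : 'I_N,
    (#|[set l | (c (l, k)).1]%SET| == i) && (#|[set l | (c (l, k)).2]%SET| == j)
      ==> (s i == j)]].
have -> : (fun w => (LISX w)%:R : R) = (fun c => (LIS (G c))%:R : R) \o code.
  apply/funext => w /=; congr (LIS _)%:R; rewrite /perm_of_points /G; congr odflt.
  apply: eq_pick => s; apply: eq_forallb => k.
  have -> : rank (fun l => (X l w).1) k = #|[set l | (code w (l, k)).1]%SET|.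
    by apply: eq_card => l; rewrite !inE ffunE.
  have -> // : rank (fun l => (X l w).2) k = #|[set l | (code w (l, k)).2]%SET|.
  by apply: eq_card => l; rewrite !inE ffunE.
apply: finite_valued_measurable => c.
have -> : code @^-1` [set c] = \bigcap_(p in [set: 'I_N * 'I_N])
    ((fun w => (X p.1 w).1 < (X p.2 w).1) @^-1` [set (c p).1] `&`
     (fun w => (X p.1 w).2 < (X p.2 w).2) @^-1` [set (c p).2]).
  apply/seteqP; split => [w <- p _|w H]; first by rewrite /code ffunE.
  apply/ffunP => p; rewrite ffunE; have [/= -> ->] := H p Logic.I.
  by case: (c p).
apply: fin_bigcap_measurable => // p _; apply: measurableI; rewrite -[X in measurable X]setTI.
  by apply: measurable_fun_ltr.
by apply: measurable_fun_ltr.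
Qed.

Variable mu : set (R * R) -> \bar R.
Hypothesis iidX : iid_with_law mu X.

Lemma iid_bigcap_le (J : {set 'I_N}) (A : set (R * R)) (p : R) :
  measurable A -> (forall i, P (X i @^-1` A) <= p%:E)%E ->
  (P (\bigcap_(i in [set` J]) (X i @^-1` A)) <= (p ^+ #|J|)%:E)%E.
Proof.
move=> mA Ap; have [ind _] := iidX.
have finP i : P (X i @^-1` A) = (fine (P (X i @^-1` A)))%:E.
  by rewrite fineK// fin_num_measure//; exact: measurable_funPTI.
rewrite ind//; under eq_bigr do rewrite finP; rewrite prodEFin lee_fin -prodr_const.
by apply: ler_prod => i _; rewrite fine_ge0//= -lee_fin -finP.
Qed.

Lemma law_preimage i (A : set (R * R)) : measurable A -> P (X i @^-1` A) = mu A.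
Proof. by have [_ law] := iidX; exact: law. Qed.

Lemma measurable_coincidence (phi : R * R -> R) i j :
  measurable_fun setT phi -> measurable [set w | phi (X i w) = phi (X j w)].
Proof.
move=> mphi; have mphiX k : measurable_fun setT (phi \o X k) by exact: measurableT_comp.
have := measurable_fun_eqr (mphiX i) (mphiX j).
move=> /(_ measurableT [set true] I); rewrite setTI.
by congr measurable; apply/seteqP; split => w /= /eqP.
Qed.

(* A coincidence puts two independent samples in one of the [n.+1] strips of width
   [n.+1%:R^-1], which has probability at most [D ^+ 2 / n.+1%:R]. *)
Lemma coincidence_null (phi : R * R -> R) (D : R) :
  measurable_fun setT phi -> (forall z, unit_square z -> 0 <= phi z <= 1) ->
  mu (~` unit_square) = 0%E ->
  (forall p h : R, (0 < h)%R -> mu (phi @^-1` `[p, (p + h)%R]) <= (D * h)%:E)%E ->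
  forall i j, i != j -> P [set w | phi (X i w) = phi (X j w)] = 0%E.
Proof.
move=> mphi phi01 mu0 muD i j ij.
have mtie := measurable_coincidence i j mphi.
have bound (n : nat) : (P [set w | phi (X i w) = phi (X j w)] <= (D ^+ 2 / n.+1%:R)%:E)%E.
  pose h : R := n.+1%:R^-1; have h0 : 0 < h by rewrite invr_gt0.
  pose S (k : 'I_n.+1) := phi @^-1` `[(k%:R * h)%R, (k%:R * h + h)%R].
  have mS k : measurable (S k) by rewrite -[X in measurable X]setTI; exact: mphi.
  pose J := [set i; j]%SET.
  pose F k := \bigcap_(l in [set` J]) (X l @^-1` S k).
  have mF k : measurable (F k).
    by apply: fin_bigcap_measurable => // l _; exact: measurable_funPTI.
  (* Samples outside the square may miss every strip, which costs only a null event by [mu0]. *)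
  have sub : [set w | phi (X i w) = phi (X j w)] `<=`
      (X i @^-1` (~` unit_square)) `|` \bigcup_(k in [set` enum 'I_n.+1]) F k.
    move=> w /= tie; have [sq|nsq] := pselect (unit_square (X i w)); last by left.
    right; exists (Ordinal (grid_cell_lt n (phi (X i w)))); first by rewrite /= mem_enum.
    have cell := grid_cell_itv n (phi01 _ sq).
    by move=> l; rewrite /= !inE /S /= => /orP[] /eqP ->; rewrite -?tie.
  apply: (@le_trans _ _ (P (X i @^-1` (~` unit_square)) +
      P (\bigcup_(k in [set` enum 'I_n.+1]) F k))%E).
    apply: le_trans (measureU2 _ _ _); last 2 first.
    - by apply: measurable_funPTI => //; apply: measurableC; exact: measurable_unit_square.
    - by rewrite bigcup_seq; exact: bigsetU_measurable.
    apply: le_measure => //; rewrite inE//; apply: measurableU.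
      by apply: measurable_funPTI => //; apply: measurableC; exact: measurable_unit_square.
    by rewrite bigcup_seq; exact: bigsetU_measurable.
  rewrite law_preimage ?mu0 ?add0e; last first.
    by apply: measurableC; exact: measurable_unit_square.
  apply: le_trans (@measure_finite_union_le _ _ _ P _ (enum 'I_n.+1) F ((D * h) ^+ 2) mF _) _.
    move=> k _; have <- : #|J| = 2%N by rewrite cards2 ij.
    by apply: iid_bigcap_le => // l; rewrite law_preimage//; exact: muD.
  rewrite size_enum_ord lee_fin /h.
  (* There are [n.+1] strips, each contributing the square of [D / n.+1]. *)
  rewrite le_eqVlt; apply/orP; left; apply/eqP; field.
  by rewrite -mulrS pnatr_eq0.
apply/eqP; rewrite eq_le measure_ge0 andbT; apply/lee_addgt0Pr => e e0; rewrite add0e.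
(* This choice of [n] makes [D ^+ 2 / n.+1] smaller than [e]. *)
apply: le_trans (bound (Num.truncn (D ^+ 2 / e))) _.
by rewrite lee_fin ler_pdivrMr// mulrC -ler_pdivrMr// ltW// truncnS_gt.
Qed.

Definition generic_points (z : 'I_N -> R * R) : Prop :=
  [/\ injective (fst \o z), injective (snd \o z) & forall i, unit_square (z i)].

(** There are finitely many pairs of samples, and [coincidence_null] with [phi] equal to each
    projection excludes a tie for each pair. *)
Lemma ae_generic_points (D : R) :
  mu (~` unit_square) = 0%E ->
  (forall p h : R, (0 < h)%R -> mu (`[p, (p + h)%R] `*` setT) <= (D * h)%:E)%E ->
  (forall p h : R, (0 < h)%R -> mu (setT `*` `[p, (p + h)%R]) <= (D * h)%:E)%E ->
  {ae P, forall w, generic_points (fun i => X i w)}.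
Proof.
move=> mu0 mu1 mu2.
have inj_ae (phi : R * R -> R) : measurable_fun setT phi ->
    (forall z, unit_square z -> 0 <= phi z <= 1) ->
    (forall p h : R, (0 < h)%R -> mu (phi @^-1` `[p, (p + h)%R]) <= (D * h)%:E)%E ->
    {ae P, forall w, injective (phi \o (fun i => X i w))}.
  move=> mphi phi01 muphi.
  suff : {ae P, forall w, forall p : 'I_N * 'I_N, p.1 != p.2 ->
      phi (X p.1 w) != phi (X p.2 w)}.
    apply: filterS => w H i j /= eij; apply/eqP; apply/negPn/negP => ij.
    by have := H (i, j) ij; rewrite /= eij eqxx.
  apply: filter_forall => -[i j] /=; have [<-|ij] := eqVneq i j.
    exact: aeW.
  exists [set w | phi (X i w) = phi (X j w)]; split.
  - exact: measurable_coincidence.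
  - exact: (coincidence_null mphi phi01 mu0 muphi).
  - by move=> w /= /not_implyP[_ /negP]; rewrite negbK => /eqP.
have sq_ae : {ae P, forall w, forall i, unit_square (X i w)}.
  apply: filter_forall => i; have msq := measurableC (@measurable_unit_square R).
  exists (X i @^-1` (~` unit_square)); split => //.
  - exact: measurable_funPTI.
  - by rewrite law_preimage.
have fst_ae : {ae P, forall w, injective (fst \o (fun i => X i w))}.
  apply: inj_ae; first exact: measurable_fst.
    by move=> z [+ _] => /=; rewrite in_itv/=.
  move=> p h /(mu1 p); congr (mu _ <= _)%E.
  by apply/seteqP; split => [z []|z] //; split.
have snd_ae : {ae P, forall w, injective (snd \o (fun i => X i w))}.
  apply: inj_ae; first exact: measurable_snd.
    by move=> z [_ +] => /=; rewrite in_itv/=.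
  move=> p h /(mu2 p); congr (mu _ <= _)%E.
  by apply/seteqP; split => [z []|z] //; split.
by move: fst_ae snd_ae sq_ae; apply: filterS3 => w; split.
Qed.

Hypothesis ae_generic : {ae P, forall w, generic_points (fun i => X i w)}.

Lemma LIS_le_size (s : 'S_N) : (LIS s <= N)%N.
Proof. by apply/bigmax_leqP => k _; rewrite -ltnS. Qed.

Lemma expected_LISE : expected_LIS X = fine (\int[P]_w ((LISX w)%:R : R)%:E).
Proof. by rewrite /expected_LIS unlock. Qed.

Lemma integral_LIS_fin_num : (\int[P]_w ((LISX w)%:R : R)%:E)%E \is a fin_num.
Proof.
rewrite ge0_fin_numE; last by apply: integral_ge0 => w _; rewrite lee_fin.
apply: (@le_lt_trans _ _ (N%:R%:E * P setT)%E).
  apply: le_integral_cst_measure => //.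
  - by apply/measurable_EFinP; exact: measurable_LIS.
  - by move=> w _; rewrite lee_fin ler_nat LIS_le_size.
by rewrite probability_setT mule1 ltry.
Qed.

(** By independence each [E k] is missed by all samples with probability at most [(1 - p) ^+ N].
    Almost surely, one sample from each hit set forms a chain, so the number of hit sets is at most
    the LIS; the claim follows by linearity of expectation. *)
Lemma expected_LIS_lb (m : nat) (E : 'I_m -> set (R * R)) (p : R) :
  (forall k, measurable (E k)) -> (forall k, p%:E <= mu (E k))%E ->
  (forall (k k' : 'I_m) z z', (k < k')%N -> E k z -> E k' z' -> z.1 < z'.1 /\ z.2 < z'.2) ->
  m%:R * (1 - (1 - p) ^+ N) <= expected_LIS X.
Proof.
move=> mE pE Elt.
rewrite -lee_fin expected_LISE fineK ?integral_LIS_fin_num//.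
pose U k := \bigcup_(i in [set: 'I_N]) (X i @^-1` E k).
have mXE k i : measurable (X i @^-1` E k) by exact: measurable_funPTI.
have mU k : measurable (U k) by apply: fin_bigcup_measurable.
have PU k : ((1 - (1 - p) ^+ N)%:E <= P (U k))%E.
  rewrite -[U k]setCK probability_setC ?EFinB; last exact: measurableC.
  apply: leeB => //; rewrite /U setC_bigcup.
  have := @iid_bigcap_le [set: 'I_N]%SET (~` E k) (1 - p); rewrite cardsT card_ord.
  rewrite (_ : [set` [set: 'I_N]%SET] = [set: 'I_N]); last first.
    by apply/seteqP; split => // i _ /=; rewrite inE.
  apply; first exact: measurableC.
  move=> i; rewrite -preimage_setC probability_setC// law_preimage//.
  by rewrite EFinB leeB.
apply: (@le_trans _ _ (\int[P]_w (\sum_(k < m) (\1_(U k) w)%:E))%E).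
  rewrite ge0_integral_sum//; last by move=> k; apply/measurable_EFinP.
  under eq_bigr do rewrite integral_indic// setIT.
  have -> : m%:R * (1 - (1 - p) ^+ N) = \sum_(k < m) (1 - (1 - p) ^+ N).
    by rewrite sumr_const card_ord mulr_natl.
  by rewrite -sumEFin; apply: lee_sum => k _; exact: PU.
apply: ae_ge0_le_integral => //.
- by move=> w _; apply: sume_ge0 => k _; rewrite lee_fin.
- by apply: emeasurable_sum => k; apply/measurable_EFinP.
- by apply/measurable_EFinP; exact: measurable_LIS.
apply: filterS ae_generic => w [inj1 inj2 _] _.
pose K := [set k | w \in U k]%SET.
have -> : (\sum_(k < m) (\1_(U k) w : R)%:E)%E = (#|K|%:R)%:E.
  rewrite sumEFin; congr EFin; rewrite -sum1_card natr_sum [RHS]big_mkcond/=.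
  by apply: eq_bigr => k _; rewrite indicE inE; case: (w \in U k).
rewrite lee_fin ler_nat.
(* A hit set supplies an index [i0], the default value in [f]; it is irrelevant on [K]. *)
have [->|[k0 Kk0]] := set_0Vmem K; first by rewrite cards0.
have [i0 _ _] : U k0 w by move: Kk0; rewrite inE => /set_mem.
pose f k := odflt i0 [pick i | X i w \in E k].
have fE k : k \in K -> E k (X (f k) w).
  rewrite inE => /set_mem [i _ Xi]; rewrite /f; case: pickP => [j /set_mem//|/(_ i)].
  by rewrite mem_set.
(* Distinct sets cannot share a sample, since [Elt] would make a coordinate smaller than itself. *)
have fI : {in K &, injective f}.
  move=> k k' Kk Kk' ff; apply/val_inj/eqP; move: (fE _ Kk) (fE _ Kk'); rewrite ff => E1 E2.
  case: ltngtP => // lt.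
    by have [] := Elt _ _ _ _ lt E1 E2; rewrite ltxx.
  by have [] := Elt _ _ _ _ lt E2 E1; rewrite ltxx.
rewrite -(card_in_imset fI); apply: increasing_points_le_LIS => //.
move=> i j /imsetP[k Kk ->] /imsetP[k' Kk' ->].
case: (ltngtP k k') => [lt|lt|/val_inj ->]; last by rewrite ltxx.
  by have [] := Elt _ _ _ _ lt (fE _ Kk) (fE _ Kk').
by have [h1 _] := Elt _ _ _ _ lt (fE _ Kk') (fE _ Kk); rewrite (lt_gtF h1).
Qed.

(** The second term is [N], the trivial bound on the LIS, times a union bound for the event that
    some cell holds [t.+1] points, over cells and over index sets of size [t.+1]. Off this event a
    chain meets at most [n.*2.+1] cells, with at most [t] points each. *)
Lemma expected_LIS_ub (n t : nat) (p : R) : 0 <= p ->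
  (forall a b : R, (mu (`[a, (a + n.+1%:R^-1)%R] `*` `[b, (b + n.+1%:R^-1)%R]) <= p%:E)%E) ->
  expected_LIS X <= ((n.*2.+1 * t)%N)%:R +
    N%:R * ((n.+1 * n.+1)%N%:R * ('C(N, t.+1)%:R * p ^+ t.+1)).
Proof.
move=> p0 pQ.
rewrite -lee_fin expected_LISE fineK ?integral_LIS_fin_num//.
pose Q (k : 'I_n.+1 * 'I_n.+1) : set (R * R) :=
  `[(k.1%:R * n.+1%:R^-1)%R, (k.1%:R * n.+1%:R^-1 + n.+1%:R^-1)%R] `*`
  `[(k.2%:R * n.+1%:R^-1)%R, (k.2%:R * n.+1%:R^-1 + n.+1%:R^-1)%R].
have mQ k : measurable (Q k) by exact: measurableX.
have mXQ k i : measurable (X i @^-1` Q k) by exact: measurable_funPTI.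
pose all_in k (J : {set 'I_N}) := \bigcap_(i in [set` J]) (X i @^-1` Q k).
have m_all_in k J : measurable (all_in k J) by apply: fin_bigcap_measurable.
pose crowded k := \bigcup_(J in [set` enum [set J : {set 'I_N} | #|J| == t.+1]%SET]) all_in k J.
have m_crowded k : measurable (crowded k).
  by rewrite /crowded bigcup_seq; exact: bigsetU_measurable.
pose bad := \bigcup_(k in [set` enum {: 'I_n.+1 * 'I_n.+1}]) crowded k.
have m_bad : measurable bad by rewrite /bad bigcup_seq; exact: bigsetU_measurable.
have P_bad : (P bad <= ((n.+1 * n.+1)%N%:R * ('C(N, t.+1)%:R * p ^+ t.+1))%:E)%E.
  apply: le_trans (measure_finite_union_le (c := 'C(N, t.+1)%:R * p ^+ t.+1) _ _) _ => //;
    last by rewrite -cardE card_prod !card_ord.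
  move=> k _; apply: le_trans (measure_finite_union_le (c := p ^+ t.+1) _ _) _ => //; last first.
    by rewrite -cardE card_draws card_ord.
  move=> J; rewrite mem_enum inE => /eqP <-.
  by apply: iid_bigcap_le => // i; rewrite law_preimage//; exact: pQ.
pose g w : \bar R := (((n.*2.+1 * t)%N%:R)%:E + N%:R%:E * (\1_bad w)%:E)%E.
have mg1 : measurable_fun setT (fun w => (\1_bad w)%:E : \bar R) by apply/measurable_EFinP.
have -> : (((n.*2.+1 * t)%N%:R + N%:R * ((n.+1 * n.+1)%N%:R * ('C(N, t.+1)%:R * p ^+ t.+1)))%:E =
   ((n.*2.+1 * t)%N%:R)%:E + N%:R%:E * ((n.+1 * n.+1)%N%:R * ('C(N, t.+1)%:R * p ^+ t.+1))%:E)%E.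
  by rewrite EFinD EFinM.
apply: (@le_trans _ _ (\int[P]_w g w)%E); last first.
  rewrite /g ge0_integralD//; last exact: measurable_funeM.
  rewrite integral_cst// [X in (_ * X)%E]probability_setT mule1.
  rewrite ge0_integralZl_EFin//.
  rewrite integral_indic// setIT; apply: leeD => //.
  by apply: lee_wpmul2l; rewrite ?lee_fin.
apply: ae_ge0_le_integral => //.
- by apply/measurable_EFinP; exact: measurable_LIS.
- by move=> w _; rewrite /g -EFinM -EFinD lee_fin addr_ge0// mulr_ge0.
- by apply: emeasurable_funD => //; exact: measurable_funeM.
apply: filterS ae_generic => w [inj1 inj2 sq] _.
rewrite /g -EFinM -EFinD lee_fin indicE.
have [_|/negP nbad] := boolP (w \in bad).
  by rewrite mulr1 ler_wpDl// ler_nat LIS_le_size.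
rewrite mulr0 addr0 ler_nat; apply: LIS_le_increasing_points => // A incA.
apply: (@card_monotone_grid_le _ _ _ A (fun i => grid_cell n (X i w).1)
  (fun i => grid_cell n (X i w).2)).
- move=> i j iA jA; have [->|ij] := eqVneq i j; first by rewrite !leqnn.
  case: (ltgtP (X i w).1 (X j w).1) => [lt|lt|/inj1 eij].
  + by have lt2 := incA _ _ iA jA lt; rewrite (grid_cell_le _ (ltW lt)) (grid_cell_le _ (ltW lt2)).
  + have lt2 := incA _ _ jA iA lt.
    by rewrite orbC (grid_cell_le _ (ltW lt)) (grid_cell_le _ (ltW lt2)).
  + by rewrite eij eqxx in ij.
(* Both cell indices are at most [n], so their sum takes at most [n.*2.+1] values. *)
- by move=> i _; rewrite ltnS -addnn leq_add// -ltnS grid_cell_lt.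
- move=> a b; rewrite leqNgt; apply/negP => crowd; apply: nbad; rewrite inE.
  set B := [set i in A | _]%SET in crowd.
  have /card_gt0P[i0 i0B] : (0 < #|B|)%N by exact: leq_ltn_trans crowd.
  have := i0B; rewrite inE => /and3P[_ /eqP ai0 /eqP bi0].
  exists (Ordinal (grid_cell_lt n (X i0 w).1), Ordinal (grid_cell_lt n (X i0 w).2)).
    by rewrite /= mem_enum.
  (* The union bound ranges over sets of exactly [t.+1] indices, so the crowded cell is
     truncated. *)
  pose J := [set x in take t.+1 (enum B)]%SET.
  have JB : {subset J <= B} by move=> x; rewrite inE => /mem_take; rewrite mem_enum.
  exists J.
    rewrite /= mem_enum inE cardsE (card_uniqP _) ?take_uniq ?enum_uniq//.
    by rewrite size_takel// -cardE.
  move=> i /= /JB; rewrite inE => /and3P[_ /eqP ai /eqP bi].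
  have /= h1 : (0 <= (X i w).1 <= 1) by have [+ _] := sq i; rewrite /= in_itv.
  have /= h2 : (0 <= (X i w).2 <= 1) by have [_ +] := sq i; rewrite /= in_itv.
  have := grid_cell_itv n h1; have := grid_cell_itv n h2.
  by rewrite ai bi -ai0 -bi0.
Qed.

End iid_samples.

(** * Asymptotics *)

(** The left side is at most the [k]-th power of [D] over [k!]. Replacing [D] by [expR 1 * D] gains
    the factor [expR k], and what remains is a single term of the exponential series at
    [expR 1 * D]. *)
Lemma binomial_pow_le_expR (R : realType) (N k : nat) (p D : R) :
  (0 < k)%N -> 0 <= p -> 0 <= D -> N%:R * p <= D ->
  'C(N, k)%:R * p ^+ k <= expR (expR 1 * D) / expR k%:R.
Proof.
move=> k0 p0 D0 NpD.
have ffact_le : (N ^_ k <= N ^ k)%N.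
  elim: k {k0} => [|k IH]; first by rewrite ffactn0.
  by rewrite ffactnSr expnSr leq_mul ?leq_subr.
have binE : 'C(N, k)%:R * k`!%:R <= N%:R ^+ k :> R.
  by rewrite -natrM -natrX ler_nat bin_ffact.
have k_fact0 : 0 < k`!%:R :> R by rewrite ltr0n fact_gt0.
have expE : (expR 1 * D) ^+ k / k`!%:R <= expR (expR 1 * D).
  case: k k0 {ffact_le binE k_fact0} => // k _.
  apply: le_trans (expR_ge1Dxn k _); last by rewrite mulr_ge0 ?expR_ge0.
  by rewrite lerDr.
rewrite ler_pdivlMr ?expR_gt0//; apply: le_trans expE.
rewrite ler_pdivlMr// exprMn -expRM_natl mulr1 [leRHS]mulrC mulrAC ler_wpM2r ?expR_ge0//.
rewrite mulrAC; apply: (@le_trans _ _ (N%:R ^+ k * p ^+ k)).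
  by rewrite ler_wpM2r ?exprn_ge0.
by rewrite -exprMn lerXn2r// nnegrE ?mulr_ge0.
Qed.

Section asymptotics.
Variables (R : realType) (alpha : R) (rho : R * R -> R).
Hypotheses (halpha : -1 < alpha < 0) (hrho : probability_density rho).
Hypothesis hcont : {within unit_square `\` diagonal, continuous rho}.
Hypothesis hTheta : Theta_near_diagonal rho alpha.
Variables (d : nat -> measure_display) (T : forall N : nat, measurableType (d N)).
Variable P : forall N : nat, probability (T N) R.
Variable X : forall N : nat, 'I_N -> {RV (P N) >-> (R * R)%type}.
Hypothesis hX : forall N : nat, iid_with_law (mu_density rho) (@X N).
Let g : R := (alpha + 2)^-1.

Let alpha2_gt0 : 0 < alpha + 2. Proof. by have /andP[? ?] := halpha; lra. Qed.

Let g_gt0 : 0 < g. Proof. by rewrite invr_gt0. Qed.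

Let g_lt1 : g < 1.
Proof. by rewrite invf_lt1//; have /andP[? ?] := halpha; lra. Qed.

Let powRgK (x : R) : 0 <= x -> (x `^ g) `^ (2 + alpha) = x.
Proof.
move=> x0; by rewrite -powRrM [2 + _]addrC mulVf ?powRr1// lt0r_neq0.
Qed.

Let powRKg (x : R) : 0 <= x -> (x `^ (2 + alpha)) `^ g = x.
Proof.
move=> x0; by rewrite -powRrM [2 + _]addrC mulfV ?powRr1// lt0r_neq0.
Qed.

Lemma ae_generic_sample N : {ae P N, forall w, generic_points (fun i => X i w)}.
Proof.
have [mrho rho0 _] := hrho; have [_ a0] := andP halpha.
have [C C0 rhoC] := Theta_near_diagonal_ub a0 hcont hTheta.
apply: (ae_generic_points (@hX N)).
- exact: mu_density_setC.
- by move=> p h h0; exact: (mu_density_strip1 halpha mrho rho0 C0 rhoC p h0).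
- by move=> p h h0; exact: (mu_density_strip2 halpha mrho rho0 C0 rhoC p h0).
Qed.

Lemma expected_LIS_soft_ub :
  soft_O (fun N : nat => expected_LIS (@X N)) (fun N : nat => N%:R `^ g).
Proof.
have [mrho rho0 _] := hrho; have [a1 a0] := andP halpha.
have [C C0 rhoC] := Theta_near_diagonal_ub a0 hcont hTheta.
pose D := singular_constant alpha * C.
have D0 : 0 <= D by rewrite mulr_ge0 ?ltW// singular_constant_gt0.
pose B := expR (expR 1 * D); have B0 : 0 < B by exact: expR_gt0.
(* The 9 is a product of [n.*2.+1 <= 3 * y] and [t <= 3 * ln N]. The constant [4 * B] bounds the bad
   event and is absorbed because [N] at least [expR 1] gives [ln N * y >= 1]. *)
exists (9 + 4 * B), 1; split; first by lra.
exists (Num.truncn (expR 1 : R)).+1 => N N0.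
have eN : expR 1 <= N%:R :> R.
  by rewrite (le_trans (ltW (truncnS_gt _)))// ler_nat.
have N1 : 1 <= N%:R :> R by rewrite (le_trans _ eN)// ltW// expR_gt1.
have lnN : 1 <= ln (N%:R : R).
  by rewrite -ler_expR lnK// posrE; lra.
pose y : R := N%:R `^ g; rewrite -/y powRr1; last by lra.
have y1 : 1 <= y by rewrite -[leLHS](powRr0 N%:R) ler_powR// ltW.
have yN : y <= N%:R by apply: ler1_powR => //; exact: ltW.
(* With [n.+1] cells per side, the side [h] is below [1 / y]; hence [N * p <= D], a bound on the
   mean number of points per cell. *)
pose n := Num.truncn y.
have /truncn_itv/andP[ny yn] : 0 <= y by lra.
rewrite -/n in ny yn.
pose h : R := n.+1%:R^-1.
have h0 : 0 < h by rewrite invr_gt0.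
pose p := D * h `^ (2 + alpha).
have p0 : 0 <= p by rewrite mulr_ge0 ?powR_ge0.
have NpD : N%:R * p <= D.
  rewrite /p mulrCA -[leRHS]mulr1 ler_wpM2l//.
  rewrite -[X in X * _](@powRgK N%:R); last by lra.
  rewrite -powRM ?powR_ge0 ?(ltW h0)// -/y.
  have := @ge0_ler_powR _ (2 + alpha) _ (y * h) 1; rewrite powR1; apply.
  - by lra.
  - by rewrite nnegrE mulr_ge0 ?powR_ge0 ?ltW.
  - by rewrite nnegrE.
  by rewrite ler_pdivrMr// mul1r ltW.
(* The factor 3 makes [expR t.+1] exceed [N ^+ 3], which compensates [N] times the number of cells,
   at most [4 * N ^+ 3]. *)
pose t := Num.truncn (3 * ln (N%:R : R)).
have /truncn_itv/andP[tl lt] : 0 <= 3 * ln (N%:R : R) by lra.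
rewrite -/t in tl lt.
apply: le_trans (@expected_LIS_ub _ _ _ _ _ _ _ (@hX N) (@ae_generic_sample N) n t p p0 _) _.
  by move=> a b; apply: mu_density_box_ub.
have bin_le := @binomial_pow_le_expR R N t.+1 p D (ltn0Sn _) p0 D0 NpD.
have e3 : N%:R ^+ 3 <= expR t.+1%:R :> R.
  have -> : N%:R ^+ 3 = expR (3 * ln (N%:R : R)).
    by rewrite expRM_natl lnK// posrE; lra.
  by rewrite ler_expR ltW.
have nN : n.+1%:R <= 2 * N%:R :> R by rewrite -natr1; lra.
have N_gt0 : 0 < N%:R :> R by lra.
have bad_le : N%:R * ((n.+1 * n.+1)%N%:R * ('C(N, t.+1)%:R * p ^+ t.+1)) <= 4 * B.
  have bin_le3 : 'C(N, t.+1)%:R * p ^+ t.+1 <= B / N%:R ^+ 3.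
    apply: le_trans bin_le _; rewrite ler_wpM2l ?(ltW B0)//.
    by rewrite lef_pV2 ?posrE ?expR_gt0 ?exprn_gt0.
  have -> : 4 * B = N%:R * (2 * N%:R * (2 * N%:R) * (B / N%:R ^+ 3)).
    by field; rewrite gt_eqF.
  rewrite ler_wpM2l ?(ltW N_gt0)// ler_pM ?mulr_ge0 ?exprn_ge0//.
  by rewrite natrM ler_pM.
have main_le : (n.*2.+1 * t)%N%:R <= 9 * (ln (N%:R : R) * y).
  have -> : 9 * (ln (N%:R : R) * y) = 3 * y * (3 * ln (N%:R : R)) by ring.
  rewrite natrM ler_pM// -natr1 -muln2 natrM; lra.
have lny : 1 <= ln (N%:R : R) * y by rewrite -[leLHS]mulr1 ler_pM.
rewrite mulrDl mulrDl -!mulrA lerD// (le_trans bad_le)// mulrA.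
by rewrite -[leLHS]mulr1 ler_wpM2l// mulr_ge0// ltW.
Qed.

Lemma expected_LIS_soft_lb :
  soft_O (fun N : nat => N%:R `^ g) (fun N : nat => expected_LIS (@X N)).
Proof.
have [mrho rho0 _] := hrho; have [a1 a0] := andP halpha.
have [c1 [c2 [delta [c10 c12 delta0 near_diag]]]] := hTheta.
have near_lb x y : unit_square (x, y) -> 0 < `|x - y| < delta ->
    c1 * `|x - y| `^ alpha <= rho (x, y).
  by move=> sq xy; have /andP[] := near_diag _ _ sq xy.
(* A lower bound for the probability of hitting a given diagonal box, because [N * p = c1 / 4]. *)
pose q := 1 - expR (- (c1 / 4)).
have q0 : 0 < q by rewrite subr_gt0 expR_lt1 oppr_lt0 divr_gt0.
exists (2 / q), 0; split; first by rewrite divr_gt0.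
pose M := 2 + delta^-1.
have M0 : 0 < M by rewrite addr_gt0 ?invr_gt0.
(* From [y >= M] follow [h < delta] and, as [y >= 2], also [y <= 2 * n]; the summand [c1] ensures
   [p <= 1]. *)
exists (Num.truncn (M `^ (2 + alpha) + c1)).+1 => N N0.
rewrite powRr0 mulr1.
have MN : M `^ (2 + alpha) + c1 <= N%:R by rewrite (le_trans (ltW (truncnS_gt _)))// ler_nat.
have pM := powR_ge0 M (2 + alpha).
pose y : R := N%:R `^ g; rewrite -/y.
have My : M <= y.
  by rewrite -(powRKg (ltW M0)); apply: ge0_ler_powR; rewrite ?nnegrE ?(ltW g_gt0)//; lra.
pose n := Num.truncn y.
have /truncn_itv/andP[ny yn] : 0 <= y by lra.
rewrite -/n in ny yn.
have di0 : 0 < delta^-1 by rewrite invr_gt0.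
have dn : delta^-1 < n%:R by move: yn; rewrite -natr1 /M in My *; lra.
have n0 : 0 < n%:R :> R by lra.
pose h : R := n%:R^-1; have h0 : 0 < h by rewrite invr_gt0.
have hd : h < delta by rewrite /h -(invrK delta) ltf_pV2 ?posrE.
have nh : n%:R * h = 1 by rewrite mulfV// gt_eqF.
(* Quarters of the diagonal squares leave gaps of at least [h / 2] between different boxes in both
   coordinates, so the order between them is strict. *)
pose E (k : 'I_n) : set (R * R) := `[(k%:R * h)%R, (k%:R * h + h / 2)%R[ `*`
  `[(k%:R * h + h / 2)%R, (k%:R * h + h)%R].
have N_gt0 : 0 < N%:R :> R by lra.
pose p := c1 / 4 / N%:R.
have p0 : 0 < p by rewrite !divr_gt0.
(* Here the side is [1 / n] instead of [1 / n.+1]: rounding down keeps [h] at least [1 / y], so each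
   box has mass at least [p]. *)
have hN : N%:R^-1 <= h `^ (2 + alpha).
  rewrite -[leLHS](@powRgK N%:R^-1) ?invr_ge0//; apply: ge0_ler_powR.
  - lra.
  - by rewrite nnegrE powR_ge0.
  - by rewrite nnegrE ltW.
  - rewrite -powR_inv1// -powRrM mulN1r powRN.
    by rewrite lef_pV2 ?posrE// powR_gt0.
have lb : n%:R * (1 - (1 - p) ^+ N) <= expected_LIS (@X N).
  apply: (@expected_LIS_lb _ _ _ _ _ _ _ (@hX N) (@ae_generic_sample N) n E p).
  - by move=> k; exact: measurableX.
  - move=> k.
    apply: le_trans (mu_density_diagonal_box_lb a0 mrho rho0 c10 near_lb _ _ _).
    + by rewrite lee_fin /p ler_wpM2l// divr_ge0// ltW.
    + by rewrite mulr_ge0// ltW.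
    + by rewrite h0.
    + by rewrite -[X in _ + X]mul1r -mulrDl natr1 -[leRHS]nh ler_wpM2r ?(ltW h0)// ler_nat.
  - move=> k k' z z' kk' [/= + +] [/= + +].
    have : k%:R * h + h <= k'%:R * h.
      by rewrite -[X in _ + X]mul1r -mulrDl natr1 ler_wpM2r ?(ltW h0)// ler_nat.
    by rewrite !in_itv/= => kh /andP[? ?] /andP[? ?] /andP[? ?] /andP[? ?]; split; lra.
have p1 : 0 <= 1 - p.
  by rewrite subr_ge0 /p ler_pdivrMr// mul1r; lra.
have pN : (1 - p) ^+ N <= expR (- (c1 / 4)).
  have -> : - (c1 / 4) = N%:R * - p by rewrite /p; field; rewrite gt_eqF.
  rewrite expRM_natl lerXn2r ?nnegrE ?expR_ge0//.
  exact: expR_ge1Dx.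
have nq : n%:R * q <= expected_LIS (@X N).
  by apply: le_trans lb; rewrite ler_wpM2l// lerD2l lerN2.
rewrite mulrAC ler_pdivlMr//; apply: (@le_trans _ _ (2 * (n%:R * q))).
  rewrite mulrA ler_wpM2r ?(ltW q0)//; move: yn; rewrite -natr1 => yn.
  rewrite /M in My; lra.
by rewrite ler_wpM2l.
Qed.

End asymptotics.

Theorem theorem2p3 (R : realType) (alpha : R) (rho : R * R -> R)
    (halpha : -1 < alpha < 0)
    (hrho : probability_density rho)
    (hcont : {within unit_square `\` diagonal, continuous rho})
    (hTheta : Theta_near_diagonal rho alpha)
    (d : nat -> measure_display) (T : forall N : nat, measurableType (d N))
    (P : forall N : nat, probability (T N) R)
    (X : forall N : nat, 'I_N -> {RV (P N) >-> (R * R)%type})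
    (hX : forall N : nat, iid_with_law (mu_density rho) (X N)) :
  soft_Theta (fun N : nat => expected_LIS (X N))
             (fun N : nat => N%:R `^ (alpha + 2)^-1).
Proof.
split; first exact: (expected_LIS_soft_ub halpha hrho hcont hTheta hX).
exact: (expected_LIS_soft_lb halpha hrho hcont hTheta hX).
Qed.
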